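(* (Total energy conservation.) The ECSLDG method preserves the total energy of the 1D1V Vlasov-Ampère system, i.e., for $m=0,\dots,M-1$, $$TE^{m+1}=\frac12\int_0^L\int_{-v_m}^{v_m} f_h^{m+1}(x,v)\,v^2\,dv\,dx+\frac{\lambda^2}{2}\int_0^L\bigl(E_h^{m+1}(x)\bigr)^2dx=\frac12\int_0^L\int_{-v_m}^{v_m} f_h^{m}(x,v)\,v^2\,dv\,dx+\frac{\lambda^2}{2}\int_0^L\bigl(E_h^{m}(x)\bigr)^2dx=TE^m.$$
   Context: Continuous problem (dimensionless, electrons only): $\partial_t f+v\,\partial_x f-E\,\partial_v f=0$, $\lambda^2\partial_t E=-J$ with $J=-\int f v\,dv$, where $\lambda$ is the normalized Debye length, with periodic boundary conditions, on $[0,L]\times[-v_m,v_m]$. (In the velocity cutoff $v_m$ the subscript is not the time index.) It is assumed that $f$ has compact support in velocity, and $v_m$ is taken sufficiently large that $f(x,v,0)$ is compactly supported on $[-v_m,v_m]$. Time levels $0=t_0<t_1<\dots<t_M=T$, with time step $\Delta t=T/M$. Mesh and spaces. $0=x_{1/2}<\dots<x_{N_x+1/2}=L$, $X_i=[x_{i-1/2},x_{i+1/2}]$; $-v_m=v_{1/2}<\dots<v_{N_v+1/2}=v_m$, $V_j=[v_{j-1/2},v_{j+1/2}]$. $\mathcal D_k(\mathcal E_x)$ (resp. $\mathcal D_k(\mathcal E_v)$) is the space of piecewise discontinuous polynomials of degree $k$ on the cells $X_i$ (resp. $V_j$). On each cell $X_i\times V_j$ take the $(k+1)^2$ tensor-product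 Gaussian nodes $(x_{i,p},v_{j,q})$, $p,q=1,\dots,k+1$, with Gaussian weights $w_{i,p}$ (for $x_{i,p}$ on $X_i$) and $w_{j,q}$ (for $v_{j,q}$ on $V_j$); the $(k+1)$-point quadrature is exact for polynomials of degree less than $2k+2$. The numerical solution $f_h$ lies in $\mathcal D_k(\mathcal E_x)\otimes\mathcal D_k(\mathcal E_v)$, so it is determined by its restrictions to the lines $v=v_{j,q}$, or by its restrictions to the lines $x=x_{i,p}$; $E_h$ is determined by its values at the nodes $x_{i,p}$. Functions of $x$ are extended periodically, and $f_h$ is taken to be zero outside $[-v_m,v_m]$ in $v$. The initial values $f_h^0(x_{i,p},v)$ on the boundary cells $V_1$ and $V_{N_v}$ are set to $0$. The initial field values $E_h^0(x_{i,p})$ are obtained by solving the Poisson equation $-\lambda^2\phi''=1-n$, $E=-\phi'$, with $n=\int f\,dv$, by a local discontinuous Galerkin method. ECSLDG method (second-order Strang splitting), from $t_m$ to $t_{m+1}$. Step 1 ($x$-direction, half step): for each fixed $v_{j,q}$, seek $f_h^*(\cdot,v_{j,q})\in\mathcal D_k(\mathcal E_x)$ such that for $i=1,\dots,N_x$ and all $\Psi\in\mathcal D_k(\mathcal E_x)$ $$\int_{X_i} f_h^*(x,v_{j,q})\Psi(x)\,dx=\int_{X_i^\star} f_h^m(x,v_{j,q})\Psi(x+v_{j,q}\Delta t/2)\,dx,$$ with $X_i^\star=[x_{i-1/2}-v_{j,q}\Delta t/2,\;x_{i+1/2}-v_{j,q}\Delta t/2]$. Step 2 ($v$-direction, full step):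 for each fixed $x_{i,p}$, compute $$E_h^{m+1}(x_{i,p})=\frac{\lambda^2-\theta(x_{i,p})}{\lambda^2+\theta(x_{i,p})}E_h^m(x_{i,p})-\frac{\Delta t}{\lambda^2+\theta(x_{i,p})}J_h^*(x_{i,p}),\qquad E_h^{m+1/2}(x_{i,p})=\tfrac12\bigl(E_h^m(x_{i,p})+E_h^{m+1}(x_{i,p})\bigr),$$ where $\theta(x_{i,p})=\frac{\Delta t^2}{4}n_h^*(x_{i,p})$, $n_h^*(x_{i,p})=\sum_{j=1}^{N_v}\sum_{q=1}^{k+1}w_{j,q}f_h^*(x_{i,p},v_{j,q})$ and $J_h^*(x_{i,p})=-\sum_{j=1}^{N_v}\sum_{q=1}^{k+1}w_{j,q}f_h^*(x_{i,p},v_{j,q})v_{j,q}$. Then seek $f_h^{**}(x_{i,p},\cdot)\in\mathcal D_k(\mathcal E_v)$ such that for $j=1,\dots,N_v$ and all $\Psi\in\mathcal D_k(\mathcal E_v)$ $$\int_{V_j} f_h^{**}(x_{i,p},v)\Psi(v)\,dv=\int_{V_j^\star} f_h^*(x_{i,p},v)\Psi\bigl(v-E_h^{m+1/2}(x_{i,p})\Delta t\bigr)\,dv,$$ with $V_j^\star=[v_{j-1/2}+E_h^{m+1/2}(x_{i,p})\Delta t,\;v_{j+1/2}+E_h^{m+1/2}(x_{i,p})\Delta t]$. Step 3 ($x$-direction, half step): repeat Step 1 starting from $f_h^{**}$ to obtain $f_h^{m+1}$; $E_h^{m+1}$ is unchanged.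
   Formalization: Assumes polynomial degree k ≥ 2 (conservation fails for k = 1, as v² is then not a test function) and that v_m is large enough that at every step the v-shift by E_h^{m+1/2}Δt carries no velocity support of f_h^* out of [-v_m, v_m]; otherwise energy is lost. *)

(* Defs.v *)
From Stdlib Require Import Reals Lra Lia.
From Coquelicot Require Import Coquelicot.
Open Scope R_scope.

(* Cells, nodes and time levels are numbered from 0, and [sum_f_R0 F n] has
   n+1 terms: [sum_f_R0 _ k] runs over the k+1 nodes of a cell and
   [sum_f_R0 _ (pred N)] over N cells. *)

Definition is_poly (d : nat) (P : R -> R) : Prop :=
  exists c : nat -> R, forall x, P x = sum_f_R0 (fun a => c a * x ^ a) d.

(* Cell i is the interval [edge i, edge (S i)], carrying the quadrature nodes
   [node i p] and weights [weight i p], p = 0..k. *)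
Record grid := {
  ncells : nat;
  edge : nat -> R;
  node : nat -> nat -> R;
  weight : nat -> nat -> R
}.

(* Exactness up to degree 2k+1 characterizes the (k+1)-point Gauss rule. *)
Definition gauss_grid (k : nat) (a b : R) (G : grid) : Prop :=
  (0 < ncells G)%nat /\ edge G 0 = a /\ edge G (ncells G) = b /\
  (forall i, (i < ncells G)%nat -> edge G i < edge G (S i)) /\
  (forall i, (i < ncells G)%nat ->
     (forall p, (p <= k)%nat -> edge G i < node G i p < edge G (S i)) /\
     (forall p, (p < k)%nat -> node G i p < node G i (S p)) /\
     (forall P, is_poly (2 * k + 1) P ->
        RInt P (edge G i) (edge G (S i))
        = sum_f_R0 (fun p => weight G i p * P (node G i p)) k)).

(* Elements of D_k are two-valued at the cell interfaces; here a function of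
   D_k may take any single value there. *)
Definition in_Dk (k : nat) (G : grid) (g : R -> R) : Prop :=
  forall i, (i < ncells G)%nat ->
    exists P, is_poly k P /\
      forall x, edge G i < x < edge G (S i) -> g x = P x.

Record setup := {
  lambda : R;
  L : R;
  vm : R;
  T : R;
  M : nat;
  k : nat;
  Gx : grid;
  Gv : grid;
  lambda_pos : 0 < lambda;
  L_pos : 0 < L;
  vm_pos : 0 < vm;
  T_pos : 0 < T;
  M_pos : (0 < M)%nat;
  Gx_gauss : gauss_grid k 0 L Gx;
  Gv_gauss : gauss_grid k (- vm) vm Gv
}.

Definition dt (D : setup) : R := T D / INR (M D).

(* Finite sums of products g(x) h(v), i.e. D_k(E_x) (x) D_k(E_v), extended
   L-periodically in x and by zero in v. *)
Definition dg_density (D : setup) (f : R -> R -> R) : Prop :=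
  (exists (r : nat) (g h : nat -> R -> R),
     (forall l, in_Dk (k D) (Gx D) (g l)) /\
     (forall l, in_Dk (k D) (Gv D) (h l)) /\
     forall x v, 0 <= x <= L D -> - vm D <= v <= vm D ->
       f x v = sum_f_R0 (fun l => g l x * h l v) r) /\
  (forall x v, f (x + L D) v = f x v) /\
  (forall x v, v < - vm D \/ vm D < v -> f x v = 0).

Definition dg_field (D : setup) (E : R -> R) : Prop :=
  in_Dk (k D) (Gx D) E /\ (forall x, E (x + L D) = E x).

Definition x_half_step (D : setup) (f f' : R -> R -> R) : Prop :=
  dg_density D f' /\
  forall j q, (j < ncells (Gv D))%nat -> (q <= k D)%nat ->
  forall i, (i < ncells (Gx D))%nat ->
  forall Psi, in_Dk (k D) (Gx D) Psi ->
    let v := node (Gv D) j q in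
    let s := v * dt D / 2 in
    RInt (fun x => f' x v * Psi x) (edge (Gx D) i) (edge (Gx D) (S i))
    = RInt (fun x => f x v * Psi (x + s))
        (edge (Gx D) i - s) (edge (Gx D) (S i) - s).

Definition n_h (D : setup) (f : R -> R -> R) (x : R) : R :=
  sum_f_R0 (fun j => sum_f_R0 (fun q =>
    weight (Gv D) j q * f x (node (Gv D) j q)) (k D))
  (pred (ncells (Gv D))).

Definition J_h (D : setup) (f : R -> R -> R) (x : R) : R :=
  - sum_f_R0 (fun j => sum_f_R0 (fun q =>
      weight (Gv D) j q * f x (node (Gv D) j q) * node (Gv D) j q) (k D))
    (pred (ncells (Gv D))).

Definition theta (D : setup) (f : R -> R -> R) (x : R) : R :=
  (dt D) ^ 2 / 4 * n_h D f x.

(* The numerical density n_h may be negative, so the non-vanishing of the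
   denominator is part of the update being defined. *)
Definition field_update (D : setup) (fs : R -> R -> R) (E E' : R -> R) : Prop :=
  dg_field D E' /\
  forall i p, (i < ncells (Gx D))%nat -> (p <= k D)%nat ->
    let x := node (Gx D) i p in
    lambda D ^ 2 + theta D fs x <> 0 /\
    E' x = (lambda D ^ 2 - theta D fs x) / (lambda D ^ 2 + theta D fs x) * E x
           - dt D / (lambda D ^ 2 + theta D fs x) * J_h D fs x.

Definition E_half (E E' : R -> R) (x : R) : R := / 2 * (E x + E' x).

Definition v_step (D : setup) (Eh : R -> R) (f f' : R -> R -> R) : Prop :=
  dg_density D f' /\
  forall i p, (i < ncells (Gx D))%nat -> (p <= k D)%nat ->
  forall j, (j < ncells (Gv D))%nat ->
  forall Psi, in_Dk (k D) (Gv D) Psi ->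
    let x := node (Gx D) i p in
    let s := Eh x * dt D in
    RInt (fun v => f' x v * Psi v) (edge (Gv D) j) (edge (Gv D) (S j))
    = RInt (fun v => f x v * Psi (v - s))
        (edge (Gv D) j + s) (edge (Gv D) (S j) + s).

Definition zero_on_boundary_cells (D : setup) (f : R -> R -> R) : Prop :=
  forall i p, (i < ncells (Gx D))%nat -> (p <= k D)%nat ->
  forall v,
    edge (Gv D) 0 < v < edge (Gv D) 1 \/
    edge (Gv D) (pred (ncells (Gv D))) < v < edge (Gv D) (ncells (Gv D)) ->
    f (node (Gx D) i p) v = 0.

(* f m, E m: solution at level m; fs m, fss m: the intermediate f*, f** of the
   step from t_m to t_{m+1}.  The initial field is any element of D_k. *)
Definition ecsldg (D : setup) (f fs fss : nat -> R -> R -> R)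
    (E : nat -> R -> R) : Prop :=
  dg_density D (f 0%nat) /\ zero_on_boundary_cells D (f 0%nat) /\
  dg_field D (E 0%nat) /\
  forall m, (m < M D)%nat ->
    x_half_step D (f m) (fs m) /\
    field_update D (fs m) (E m) (E (S m)) /\
    v_step D (E_half (E m) (E (S m))) (fs m) (fss m) /\
    x_half_step D (fss m) (f (S m)).

(* "v_m is sufficiently large": a point v of the velocity support of f* moves
   to v - E dt in the v-step, and must stay within the cutoff. *)
Definition cutoff_large_enough (D : setup) (fs : nat -> R -> R -> R)
    (E : nat -> R -> R) : Prop :=
  forall m, (m < M D)%nat ->
  forall i p, (i < ncells (Gx D))%nat -> (p <= k D)%nat ->
  forall j v, (j < ncells (Gv D))%nat ->
    edge (Gv D) j < v < edge (Gv D) (S j) ->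
    let x := node (Gx D) i p in
    fs m x v <> 0 ->
    - vm D <= v - E_half (E m) (E (S m)) x * dt D <= vm D.

Definition TE (D : setup) (f : R -> R -> R) (E : R -> R) : R :=
  / 2 * RInt (fun x => RInt (fun v => f x v * v ^ 2) (- vm D) (vm D)) 0 (L D)
  + lambda D ^ 2 / 2 * RInt (fun x => (E x) ^ 2) 0 (L D).

(* Main.v *)
Require Import Defs.
From Stdlib Require Import Reals Lra Lia.
From Coquelicot Require Import Coquelicot.
Open Scope R_scope.

(** The total energy is a purely discrete quantity.  The (k+1)-point Gauss rule
    is exact in degree 2k+1, and, for k >= 2, the integrands f v^2 (degree k+2 in v,
    degree k in x) and E^2 (degree 2k) stay within that degree on every cell.
    Hence both integrals of the energy equal their nodal sums
    ([kinetic_energy_quadrature], [gauss_RInt]), and it suffices to follow the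
    nodal values through the three substeps.

    The x-steps do not touch the kinetic energy: on a line v = v_{j,q} the test
    function 1 and periodicity give conservation of the integral of f over a
    period ([x_half_step_mass]), and the kinetic energy is a combination of
    these integrals with the fixed coefficients w_{j,q} v_{j,q}^2.

    The v-step at a node x, tested with v^2 (an element of D_k because k >= 2),
    replaces the second moment of f* by that of the translate v |-> f*(v + s), where
    s = E^{m+1/2} dt.
    No mass crosses the velocity cutoff, so expanding (v - s)^2 yields the change
    2 s J + s^2 n ([v_step_second_moment]).  The field update is the implicit
    midpoint rule lambda^2 (E' - E) = - dt J - 2 theta E^{m+1/2}; multiplied by
    E' + E = 2 E^{m+1/2} it says that lambda^2 (E'^2 - E^2) is the opposite of that
    change ([field_update_energy]).  So in the v-step kinetic and field energy
    balance at each node x. *)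

(** * Finite sums and polynomials *)

Lemma is_poly_ext d P Q : (forall x, P x = Q x) -> is_poly d P -> is_poly d Q.
Proof. intros H [c Hc]. exists c. intros x. now rewrite <- H. Qed.

Lemma is_poly_S d P : is_poly d P -> is_poly (S d) P.
Proof.
  intros [c Hc]. exists (fun a => if Nat.leb a d then c a else 0).
  intros x. rewrite Hc, tech5, (proj2 (Nat.leb_gt (S d) d)) by lia.
  rewrite Rmult_0_l, Rplus_0_r. apply sum_eq. intros i Hi.
  now rewrite (proj2 (Nat.leb_le i d) Hi).
Qed.

Lemma is_poly_le d e P : (d <= e)%nat -> is_poly d P -> is_poly e P.
Proof. induction 1; auto using is_poly_S. Qed.

Lemma is_poly_plus d P Q :
  is_poly d P -> is_poly d Q -> is_poly d (fun x => P x + Q x).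
Proof.
  intros [c Hc] [c' Hc']. exists (fun a => c a + c' a). intros x.
  rewrite Hc, Hc', <- sum_plus. apply sum_eq. intros; ring.
Qed.

Lemma is_poly_scal d c P : is_poly d P -> is_poly d (fun x => c * P x).
Proof.
  intros [b Hb]. exists (fun a => c * b a). intros x.
  rewrite Hb, scal_sum. apply sum_eq. intros; ring.
Qed.

Lemma is_poly_const d c : is_poly d (fun _ => c).
Proof.
  apply (is_poly_le 0); [lia|]. exists (fun _ => c). intros x; simpl; ring.
Qed.

Lemma is_poly_mulX d P : is_poly d P -> is_poly (S d) (fun x => x * P x).
Proof.
  intros [c Hc]. exists (fun a => match a with O => 0 | S b => c b end).
  intros x. rewrite decomp_sum by lia. simpl pred.
  rewrite Rmult_0_l, Rplus_0_l, Hc, scal_sum.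
  apply sum_eq. intros; simpl; ring.
Qed.

Lemma is_poly_mult d e P Q :
  is_poly d P -> is_poly e Q -> is_poly (d + e) (fun x => P x * Q x).
Proof.
  intros [c Hc] HQ.
  apply (is_poly_ext _ (fun x => sum_f_R0 (fun a => c a * x ^ a) d * Q x));
    [intros x; now rewrite Hc|].
  assert (Hmono : forall a, is_poly (a + e) (fun x => x ^ a * Q x)).
  { induction a as [|a IHa].
    - apply (is_poly_ext _ Q); [intros; simpl; ring|exact HQ].
    - apply (is_poly_ext _ (fun x => x * (x ^ a * Q x))); [intros; simpl; ring|].
      now apply is_poly_mulX. }
  clear Hc. induction d as [|d IHd].
  - apply (is_poly_ext _ (fun x => c O * (x ^ 0 * Q x))); [intros; simpl; ring|].
    apply is_poly_scal, Hmono.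
  - apply (is_poly_ext _ (fun x => sum_f_R0 (fun a => c a * x ^ a) d * Q x
                                   + c (S d) * (x ^ S d * Q x)));
      [intros; simpl; ring|].
    apply is_poly_plus; [apply is_poly_S, IHd|apply is_poly_scal, Hmono].
Qed.

Lemma is_poly_shift_sqr s : is_poly 2 (fun x => (x - s) ^ 2).
Proof.
  exists (fun a => match a with O => s ^ 2 | 1%nat => - 2 * s | _ => 1 end).
  intros x; simpl; ring.
Qed.

Lemma is_poly_continuous d P x : is_poly d P -> continuous P x.
Proof.
  intros [c Hc].
  apply (continuous_ext (fun x => sum_f_R0 (fun a => c a * x ^ a) d));
    [intros; now rewrite Hc|].
  clear Hc. induction d as [|d IHd]; simpl.
  - apply (ex_derive_continuous (V := R_NormedModule)). auto_derive. easy.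
  - apply (continuous_plus (V := R_NormedModule)); [exact IHd|].
    apply (ex_derive_continuous (V := R_NormedModule)). auto_derive. easy.
Qed.

Lemma is_poly_ex_RInt d P a b : is_poly d P -> ex_RInt P a b.
Proof.
  intros HP. apply (ex_RInt_continuous (V := R_CompleteNormedModule)).
  intros z _. now apply is_poly_continuous with d.
Qed.

(** * Piecewise polynomials *)

Lemma in_Dk_ext d G g g' :
  (forall i x, (i < ncells G)%nat -> edge G i < x < edge G (S i) -> g' x = g x) ->
  in_Dk d G g -> in_Dk d G g'.
Proof.
  intros H Hg i Hi. destruct (Hg i Hi) as [P [HP He]].
  exists P. split; [exact HP|]. intros x Hx. rewrite (H i x Hi Hx). now apply He.
Qed.

Lemma in_Dk_le d e G g : (d <= e)%nat -> in_Dk d G g -> in_Dk e G g.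
Proof.
  intros H Hg i Hi. destruct (Hg i Hi) as [P [HP He]].
  exists P. split; [now apply is_poly_le with d|exact He].
Qed.

Lemma in_Dk_poly d G P : is_poly d P -> in_Dk d G P.
Proof. intros HP i _. exists P. now split. Qed.

Lemma in_Dk_mult d e G g h :
  in_Dk d G g -> in_Dk e G h -> in_Dk (d + e) G (fun x => g x * h x).
Proof.
  intros Hg Hh i Hi.
  destruct (Hg i Hi) as [P [HP HgP]], (Hh i Hi) as [Q [HQ HhQ]].
  exists (fun x => P x * Q x). split; [now apply is_poly_mult|].
  intros x Hx. now rewrite HgP, HhQ.
Qed.

Lemma in_Dk_scal d G c g : in_Dk d G g -> in_Dk d G (fun x => c * g x).
Proof.
  intros Hg. apply (in_Dk_mult 0 d); [|exact Hg].
  apply in_Dk_poly, is_poly_const.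
Qed.

Lemma in_Dk_plus d G g h :
  in_Dk d G g -> in_Dk d G h -> in_Dk d G (fun x => g x + h x).
Proof.
  intros Hg Hh i Hi.
  destruct (Hg i Hi) as [P [HP HgP]], (Hh i Hi) as [Q [HQ HhQ]].
  exists (fun x => P x + Q x). split; [now apply is_poly_plus|].
  intros x Hx. now rewrite HgP, HhQ.
Qed.

Lemma in_Dk_sum d G (g : nat -> R -> R) n :
  (forall l, (l <= n)%nat -> in_Dk d G (g l)) ->
  in_Dk d G (fun x => sum_f_R0 (fun l => g l x) n).
Proof.
  induction n as [|n IHn]; intros Hg; simpl.
  - now apply Hg.
  - apply in_Dk_plus; [apply IHn; intros l Hl|]; apply Hg; lia.
Qed.

(** * Composite Gauss quadrature *)

Definition quad (k : nat) (G : grid) (g : R -> R) : R :=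
  sum_f_R0 (fun i => sum_f_R0 (fun p => weight G i p * g (node G i p)) k)
    (pred (ncells G)).

Lemma quad_ext k G g h :
  (0 < ncells G)%nat ->
  (forall i p, (i < ncells G)%nat -> (p <= k)%nat ->
     g (node G i p) = h (node G i p)) ->
  quad k G g = quad k G h.
Proof.
  intros HN H. apply sum_eq. intros i Hi. apply sum_eq. intros p Hp.
  rewrite H; [easy|lia|easy].
Qed.

Lemma quad_plus k G g h :
  quad k G (fun x => g x + h x) = quad k G g + quad k G h.
Proof.
  unfold quad. rewrite <- sum_plus. apply sum_eq. intros i Hi.
  rewrite <- sum_plus. apply sum_eq. intros; ring.
Qed.

Lemma quad_scal k G c g : quad k G (fun x => c * g x) = c * quad k G g.
Proof.
  unfold quad. rewrite scal_sum. apply sum_eq. intros i Hi.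
  rewrite Rmult_comm, scal_sum. apply sum_eq. intros; ring.
Qed.

Lemma quad_sum k G (g : nat -> R -> R) n :
  quad k G (fun x => sum_f_R0 (fun l => g l x) n)
  = sum_f_R0 (fun l => quad k G (g l)) n.
Proof.
  induction n as [|n IHn]; simpl; [easy|]. now rewrite quad_plus, IHn.
Qed.

Lemma quad_swap k k' G G' (g : R -> R -> R) :
  quad k G (fun x => quad k' G' (fun v => g x v))
  = quad k' G' (fun v => quad k G (fun x => g x v)).
Proof.
  unfold quad at 2. rewrite quad_sum. unfold quad at 2.
  apply sum_eq. intros i Hi. rewrite quad_sum. apply sum_eq. intros p Hp.
  apply quad_scal.
Qed.

Lemma in_Dk_quad d k G G' (g : R -> R -> R) :
  (0 < ncells G')%nat ->
  (forall j q, (j < ncells G')%nat -> (q <= k)%nat ->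
     in_Dk d G (fun x => g x (node G' j q))) ->
  in_Dk d G (fun x => quad k G' (g x)).
Proof.
  intros HN H. apply (in_Dk_sum d G (fun j x => sum_f_R0 _ k)). intros j Hj.
  apply (in_Dk_sum d G (fun q x => weight G' j q * g x (node G' j q))).
  intros q Hq. apply in_Dk_scal, H; [lia|easy].
Qed.

Lemma is_RInt_cells (F : R -> R) (e I : nat -> R) n :
  (forall i, (i <= n)%nat -> is_RInt F (e i) (e (S i)) (I i)) ->
  is_RInt F (e O) (e (S n)) (sum_f_R0 I n).
Proof.
  induction n as [|n IHn]; intros H; simpl.
  - now apply H.
  - apply (is_RInt_Chasles (V := R_NormedModule)) with (e (S n));
      [apply IHn; intros i Hi|]; apply H; lia.
Qed.

Section GaussGrid.

Context {k : nat} {a b : R} {G : grid} (HG : gauss_grid k a b G).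

Lemma gauss_ncells : (0 < ncells G)%nat.
Proof. now destruct HG. Qed.

Lemma gauss_edge_mono i j :
  (i <= j)%nat -> (j <= ncells G)%nat -> edge G i <= edge G j.
Proof.
  destruct HG as (_ & _ & _ & Hlt & _).
  induction 1 as [|j Hij IH]; intros Hj; [lra|].
  assert (edge G j < edge G (S j)) by (apply Hlt; lia).
  assert (edge G i <= edge G j) by (apply IH; lia). lra.
Qed.

Lemma gauss_cell i : (i < ncells G)%nat ->
  a <= edge G i /\ edge G i < edge G (S i) /\ edge G (S i) <= b.
Proof.
  intros Hi. pose proof (gauss_edge_mono 0 i). pose proof (gauss_edge_mono (S i) (ncells G)).
  destruct HG as (_ & <- & <- & Hlt & _).
  repeat split; [apply H; lia|now apply Hlt|apply H0; lia].
Qed.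

Lemma gauss_le : a <= b.
Proof. destruct (gauss_cell 0 gauss_ncells) as (? & ? & ?); lra. Qed.

Lemma gauss_node i p : (i < ncells G)%nat -> (p <= k)%nat ->
  edge G i < node G i p < edge G (S i).
Proof. intros Hi Hp. destruct HG as (_ & _ & _ & _ & H). now apply H. Qed.

Lemma gauss_node_range i p : (i < ncells G)%nat -> (p <= k)%nat ->
  a <= node G i p <= b.
Proof.
  intros Hi Hp. destruct (gauss_cell i Hi) as (? & ? & ?).
  destruct (gauss_node i p Hi Hp). lra.
Qed.

Lemma gauss_is_RInt_cells (F : R -> R) (I : nat -> R) :
  (forall i, (i < ncells G)%nat -> is_RInt F (edge G i) (edge G (S i)) (I i)) ->
  is_RInt F a b (sum_f_R0 I (pred (ncells G))).
Proof.
  intros H. destruct HG as (HN & Ha & Hb & _).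
  rewrite <- Ha, <- Hb.
  replace (edge G (ncells G)) with (edge G (S (pred (ncells G)))) by (f_equal; lia).
  apply is_RInt_cells. intros i Hi. apply H; lia.
Qed.

(** Both transport substeps integrate over translated cells.  These may cross
    interfaces or leave the grid, so F is asked to be integrable everywhere. *)
Lemma gauss_RInt_shifted_cells (F : R -> R) s :
  (forall u w, ex_RInt F u w) ->
  sum_f_R0 (fun i => RInt F (edge G i + s) (edge G (S i) + s)) (pred (ncells G))
  = RInt F (a + s) (b + s).
Proof.
  intros H. symmetry. apply is_RInt_unique.
  destruct HG as (HN & Ha & Hb & _).
  rewrite <- Ha, <- Hb.
  replace (edge G (ncells G)) with (edge G (S (pred (ncells G)))) by (f_equal; lia).
  apply (is_RInt_cells F (fun i => edge G i + s)). intros i _.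
  now apply (RInt_correct (V := R_CompleteNormedModule)).
Qed.

(** Changing a D_{2k+1} function at the cell interfaces does not change its
    integral, so this holds whatever its interface values are. *)
Lemma gauss_is_RInt g : in_Dk (2 * k + 1) G g -> is_RInt g a b (quad k G g).
Proof.
  intros Hg. apply gauss_is_RInt_cells. intros i Hi.
  destruct (gauss_cell i Hi) as (_ & Hlt & _).
  destruct (Hg i Hi) as [P [HP He]].
  apply (is_RInt_ext P).
  { rewrite Rmin_left, Rmax_right by lra. intros x Hx. now rewrite He. }
  replace (sum_f_R0 _ k) with (RInt P (edge G i) (edge G (S i))).
  - apply (RInt_correct (V := R_CompleteNormedModule)).
    now apply is_poly_ex_RInt with (2 * k + 1)%nat.
  - destruct HG as (_ & _ & _ & _ & H). destruct (H i Hi) as (_ & _ & Hex).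
    rewrite Hex by exact HP. apply sum_eq. intros p Hp.
    now rewrite He by now apply gauss_node.
Qed.

Lemma gauss_RInt g : in_Dk (2 * k + 1) G g -> RInt g a b = quad k G g.
Proof. intros Hg. now apply is_RInt_unique, gauss_is_RInt. Qed.

Lemma in_Dk_RInt_cells g d : in_Dk d G g ->
  sum_f_R0 (fun i => RInt g (edge G i) (edge G (S i))) (pred (ncells G))
  = RInt g a b.
Proof.
  intros Hg. symmetry. apply is_RInt_unique, gauss_is_RInt_cells.
  intros i Hi. apply (RInt_correct (V := R_CompleteNormedModule)).
  destruct (gauss_cell i Hi) as (_ & Hlt & _).
  destruct (Hg i Hi) as [P [HP He]].
  apply (ex_RInt_ext P).
  { rewrite Rmin_left, Rmax_right by lra. intros x Hx. now rewrite He. }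
  now apply is_poly_ex_RInt with d.
Qed.

End GaussGrid.

(** * Integrals of periodic and of compactly supported functions *)

Lemma RInt_ext_all (F G : R -> R) a b :
  (forall x, F x = G x) -> RInt F a b = RInt G a b.
Proof. intros H. apply RInt_ext. intros; apply H. Qed.

Lemma ex_RInt_everywhere (F : R -> R) :
  (forall r, exists c d, c <= - r /\ r <= d /\ ex_RInt F c d) ->
  forall u w, ex_RInt F u w.
Proof.
  intros H.
  assert (Hle : forall u w, u <= w -> ex_RInt F u w).
  { intros u w Huw.
    destruct (H (Rmax (Rabs u) (Rabs w))) as (c & d & Hc & Hd & Hcd).
    pose proof (Rmax_l (Rabs u) (Rabs w)). pose proof (Rmax_r (Rabs u) (Rabs w)).
    pose proof (Rabs_maj2 u). pose proof (Rle_abs w).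
    apply (ex_RInt_Chasles_2 (V := R_CompleteNormedModule)) with c; [lra|].
    apply (ex_RInt_Chasles_1 (V := R_CompleteNormedModule)) with d; [lra|easy]. }
  intros u w. destruct (Rle_dec u w) as [Huw|Huw]; [now apply Hle|].
  apply ex_RInt_swap, Hle. lra.
Qed.

Lemma is_RInt_translate (F : R -> R) s a b I :
  is_RInt F (a + s) (b + s) I -> is_RInt (fun x => F (x + s)) a b I.
Proof.
  intros H.
  apply (is_RInt_ext (fun x => scal 1 (F (1 * x + s)))).
  { intros x _. now rewrite !Rmult_1_l. }
  apply (is_RInt_comp_lin (V := R_NormedModule)).
  now rewrite !Rmult_1_l.
Qed.

Section Periodic.

Context (F : R -> R) (p : R) (p_pos : 0 < p) (HF : forall x, F (x + p) = F x)
  (F_int : ex_RInt F 0 p).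

Lemma periodic_translate a b I : is_RInt F (a + p) (b + p) I -> is_RInt F a b I.
Proof.
  intros H. apply (is_RInt_ext (fun x => F (x + p))); [intros; apply HF|].
  now apply is_RInt_translate.
Qed.

Lemma periodic_translate_back a b I :
  is_RInt F a b I -> is_RInt F (a + p) (b + p) I.
Proof.
  intros H. apply (is_RInt_ext (fun x => F (x + - p))).
  { intros x _. rewrite <- HF. f_equal; ring. }
  apply is_RInt_translate.
  replace (a + p + - p) with a by ring. now replace (b + p + - p) with b by ring.
Qed.

(** The translation v dt / 2 may exceed any number of periods, so integrability
    has to be propagated from one period to the whole line. *)
Lemma periodic_ex_RInt u w : ex_RInt F u w.
Proof.
  revert u w. apply ex_RInt_everywhere.
  assert (Hn : forall n, ex_RInt F (INR n * p) ((INR n + 1) * p) /\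
                         ex_RInt F (- ((INR n + 1) * p)) (- (INR n * p))).
  { induction n as [|n [[I HI] [I' HI']]].
    - simpl. rewrite !Rmult_0_l, Rplus_0_l, Rmult_1_l, Ropp_0. split; [easy|].
      destruct F_int as [I HI]. exists I. apply periodic_translate.
      replace (- p + p) with 0 by ring. now rewrite Rplus_0_l.
    - rewrite S_INR. split.
      + exists I. replace ((INR n + 1) * p) with (INR n * p + p) by ring.
        replace ((INR n + 1 + 1) * p) with ((INR n + 1) * p + p) by ring.
        now apply periodic_translate_back.
      + exists I'. apply periodic_translate.
        replace (- ((INR n + 1) * p) + p) with (- (INR n * p)) by ring.
        replace (- ((INR n + 1 + 1) * p) + p) with (- ((INR n + 1) * p)) by ring.
        easy. }
  assert (Hsym : forall n, ex_RInt F (- (INR n * p)) (INR n * p)).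
  { induction n as [|n IHn].
    - simpl. rewrite Rmult_0_l, Ropp_0. apply ex_RInt_point.
    - rewrite S_INR. destruct (Hn n) as [Hr Hl].
      apply (ex_RInt_Chasles (V := R_NormedModule)) with (INR n * p); [|easy].
      now apply (ex_RInt_Chasles (V := R_NormedModule)) with (- (INR n * p)). }
  intros r. destruct (INR_unbounded (r / p)) as [n Hrn].
  exists (- (INR n * p)), (INR n * p).
  assert (r < INR n * p).
  { replace r with (r / p * p) by (field; lra). now apply Rmult_lt_compat_r. }
  repeat split; [lra|lra|apply Hsym].
Qed.

Lemma periodic_RInt_shift s : RInt F (0 + s) (p + s) = RInt F 0 p.
Proof.
  pose proof periodic_ex_RInt as Hex.
  rewrite Rplus_0_l.
  rewrite <- (RInt_Chasles (V := R_CompleteNormedModule) F s 0 (p + s)) by easy.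
  rewrite <- (RInt_Chasles (V := R_CompleteNormedModule) F 0 p (p + s)) by easy.
  assert (Hend : RInt F p (p + s) = RInt F 0 s).
  { apply is_RInt_unique.
    replace p with (0 + p) at 1 by ring. rewrite (Rplus_comm p s).
    apply periodic_translate_back.
    now apply (RInt_correct (V := R_CompleteNormedModule)). }
  rewrite Hend.
  rewrite <- (opp_RInt_swap (V := R_CompleteNormedModule) F 0 s) by easy.
  unfold plus, opp; simpl. ring.
Qed.

End Periodic.

Lemma is_RInt_zero (F : R -> R) a b :
  a <= b -> (forall x, a < x < b -> F x = 0) -> is_RInt F a b 0.
Proof.
  intros Hab H. apply (is_RInt_ext (fun _ => 0)).
  { rewrite Rmin_left, Rmax_right by lra. intros x Hx. now rewrite H. }
  pose proof (is_RInt_const (V := R_NormedModule) a b 0) as Hc.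
  now rewrite (scal_zero_r (V := R_NormedModule)) in Hc.
Qed.

Lemma is_RInt_extend_zero (F : R -> R) c a b d I :
  c <= a -> a <= b -> b <= d ->
  (forall x, x < a \/ b < x -> F x = 0) ->
  is_RInt F a b I -> is_RInt F c d I.
Proof.
  intros Hca Hab Hbd H HI.
  replace I with (plus (plus 0 I) 0) by (unfold plus; simpl; ring).
  apply (is_RInt_Chasles (V := R_NormedModule)) with b.
  - apply (is_RInt_Chasles (V := R_NormedModule)) with a; [|easy].
    apply is_RInt_zero; [easy|]. intros; apply H; lra.
  - apply is_RInt_zero; [easy|]. intros; apply H; lra.
Qed.

Lemma compact_support_ex_RInt (F : R -> R) a b :
  a <= b -> (forall x, x < a \/ b < x -> F x = 0) -> ex_RInt F a b ->
  forall u w, ex_RInt F u w.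
Proof.
  intros Hab H [I HI]. apply ex_RInt_everywhere. intros r.
  exists (Rmin a (- r)), (Rmax b r).
  pose proof (Rmin_l a (- r)). pose proof (Rmin_r a (- r)).
  pose proof (Rmax_l b r). pose proof (Rmax_r b r).
  repeat split; [lra|lra|]. exists I.
  now apply is_RInt_extend_zero with a b.
Qed.

(** Both sides equal the integral over the hull of the two intervals. *)
Lemma compact_support_RInt_eq (F : R -> R) a b c d :
  a <= b -> c <= d ->
  (forall x, x < a \/ b < x -> F x = 0) ->
  (forall x, x < c \/ d < x -> F x = 0) ->
  ex_RInt F a b -> RInt F c d = RInt F a b.
Proof.
  intros Hab Hcd H H' Hex.
  pose proof (compact_support_ex_RInt F a b Hab H Hex) as Hall.
  pose proof (Rmin_l a c). pose proof (Rmin_r a c).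
  pose proof (Rmax_l b d). pose proof (Rmax_r b d).
  transitivity (RInt F (Rmin a c) (Rmax b d)); [symmetry|];
    apply is_RInt_unique.
  - apply is_RInt_extend_zero with c d; try easy.
    now apply (RInt_correct (V := R_CompleteNormedModule)).
  - apply is_RInt_extend_zero with a b; try easy.
    now apply (RInt_correct (V := R_CompleteNormedModule)).
Qed.

(** Vanishing outside [c, d] is only required on the open cells: interface values
    of F are arbitrary, so F is first replaced by its truncation to [c, d],
    which has the same integral over each cell. *)
Lemma gauss_RInt_truncate k a b G (F : R -> R) c d :
  gauss_grid k a b G -> c <= d ->
  (forall x, x < a \/ b < x -> F x = 0) ->
  (forall i x, (i < ncells G)%nat -> edge G i < x < edge G (S i) ->
     F x <> 0 -> c <= x <= d) ->
  (forall i, (i < ncells G)%nat -> ex_RInt F (edge G i) (edge G (S i))) ->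
  RInt F c d = RInt F a b.
Proof.
  intros HG Hcd Hout Hin Hex.
  set (F0 := fun x => if Rle_dec c x then if Rle_dec x d then F x else 0 else 0).
  assert (F0_in : forall x, c <= x <= d -> F0 x = F x).
  { intros x Hx. unfold F0. destruct (Rle_dec c x), (Rle_dec x d); lra. }
  assert (F0_out : forall x, x < c \/ d < x -> F0 x = 0).
  { intros x Hx. unfold F0. destruct (Rle_dec c x), (Rle_dec x d); lra. }
  assert (F0_cell : forall i x, (i < ncells G)%nat ->
            edge G i < x < edge G (S i) -> F x = F0 x).
  { intros i x Hi Hx. destruct (Req_dec (F x) 0) as [H0|H0].
    - unfold F0. destruct (Rle_dec c x), (Rle_dec x d); now rewrite ?H0.
    - symmetry. now apply F0_in, (Hin i). }
  assert (HF : forall i, (i < ncells G)%nat ->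
            is_RInt F (edge G i) (edge G (S i)) (RInt F (edge G i) (edge G (S i)))).
  { intros i Hi. now apply (RInt_correct (V := R_CompleteNormedModule)), Hex. }
  assert (HF0 : forall i, (i < ncells G)%nat ->
            is_RInt F0 (edge G i) (edge G (S i)) (RInt F (edge G i) (edge G (S i)))).
  { intros i Hi. apply (is_RInt_ext F); [|now apply HF].
    destruct (gauss_cell HG i Hi) as (_ & Hlt & _).
    rewrite Rmin_left, Rmax_right by lra. intros x. now apply F0_cell. }
  apply (gauss_is_RInt_cells HG) in HF, HF0.
  transitivity (RInt F0 c d).
  { apply RInt_ext. rewrite Rmin_left, Rmax_right by lra.
    intros x Hx. symmetry. apply F0_in. lra. }
  rewrite (is_RInt_unique _ _ _ _ HF), <- (is_RInt_unique _ _ _ _ HF0).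
  apply compact_support_RInt_eq; try easy.
  - apply (gauss_le HG).
  - intros x Hx. unfold F0.
    destruct (Rle_dec c x), (Rle_dec x d); try easy. now apply Hout.
  - eexists. exact HF0.
Qed.

(** * The discrete energy *)

Lemma dg_density_slice_v D f x :
  dg_density D f -> 0 <= x <= L D -> in_Dk (k D) (Gv D) (fun v => f x v).
Proof.
  intros [(r & g & h & Hg & Hh & Hf) _] Hx.
  apply (in_Dk_ext _ _ (fun v => sum_f_R0 (fun l => g l x * h l v) r)).
  - intros j v Hj Hv. apply Hf; [easy|].
    destruct (gauss_cell (Gv_gauss D) j Hj) as (? & ? & ?). lra.
  - apply (in_Dk_sum _ _ (fun l v => g l x * h l v)). intros l _.
    now apply in_Dk_scal.
Qed.

Lemma dg_density_slice_x D f v :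
  dg_density D f -> - vm D <= v <= vm D -> in_Dk (k D) (Gx D) (fun x => f x v).
Proof.
  intros [(r & g & h & Hg & Hh & Hf) _] Hv.
  apply (in_Dk_ext _ _ (fun x => sum_f_R0 (fun l => h l v * g l x) r)).
  - intros i x Hi Hx. destruct (gauss_cell (Gx_gauss D) i Hi) as (? & ? & ?).
    rewrite Hf by lra. apply sum_eq. intros; ring.
  - apply (in_Dk_sum _ _ (fun l x => h l v * g l x)). intros l _.
    now apply in_Dk_scal.
Qed.

Lemma kinetic_energy_quadrature D f :
  (1 <= k D)%nat -> dg_density D f ->
  RInt (fun x => RInt (fun v => f x v * v ^ 2) (- vm D) (vm D)) 0 (L D)
  = quad (k D) (Gx D) (fun x => quad (k D) (Gv D) (fun v => v ^ 2 * f x v)).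
Proof.
  intros Hk Hf. rewrite <- (gauss_RInt (Gx_gauss D)).
  - apply RInt_ext. pose proof (L_pos D).
    rewrite Rmin_left, Rmax_right by lra. intros x Hx.
    rewrite (gauss_RInt (Gv_gauss D)).
    + apply quad_ext; [apply (gauss_ncells (Gv_gauss D))|]. intros; ring.
    + apply (in_Dk_le (k D + 2)); [lia|]. apply in_Dk_mult.
      * apply dg_density_slice_v; [easy|lra].
      * apply in_Dk_poly, (is_poly_ext _ (fun v => (v - 0) ^ 2));
          [intros; ring|apply is_poly_shift_sqr].
  - apply (in_Dk_quad _ _ _ _ (fun x v => v ^ 2 * f x v));
      [apply (gauss_ncells (Gv_gauss D))|].
    intros j q Hj Hq. apply (in_Dk_le (k D)); [lia|].
    apply in_Dk_scal, dg_density_slice_x; [easy|].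
    now apply (gauss_node_range (Gv_gauss D)).
Qed.

Lemma TE_quadrature D f E :
  (1 <= k D)%nat -> dg_density D f -> dg_field D E ->
  TE D f E
  = / 2 * quad (k D) (Gx D) (fun x =>
      quad (k D) (Gv D) (fun v => v ^ 2 * f x v) + lambda D ^ 2 * E x ^ 2).
Proof.
  intros Hk Hf [HE _]. unfold TE. rewrite kinetic_energy_quadrature by easy.
  rewrite (gauss_RInt (Gx_gauss D)).
  - rewrite quad_plus, quad_scal. field.
  - apply (in_Dk_ext _ _ (fun x => E x * E x)); [intros; ring|].
    apply (in_Dk_le (k D + k D)); [lia|]. now apply in_Dk_mult.
Qed.

(** * Conservation in the three substeps *)

(** Summed over the cells, the test function 1 gives the integral of f over a
    translate of the period. *)
Lemma x_half_step_mass D f f' j q :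
  dg_density D f -> x_half_step D f f' ->
  (j < ncells (Gv D))%nat -> (q <= k D)%nat ->
  quad (k D) (Gx D) (fun x => f' x (node (Gv D) j q))
  = quad (k D) (Gx D) (fun x => f x (node (Gv D) j q)).
Proof.
  intros Hf [Hf' Hstep] Hj Hq. set (v := node (Gv D) j q).
  assert (Hv : - vm D <= v <= vm D) by now apply (gauss_node_range (Gv_gauss D)).
  pose proof (dg_density_slice_x D f v Hf Hv) as Dkf.
  pose proof (dg_density_slice_x D f' v Hf' Hv) as Dkf'.
  assert (Hper : forall x, f (x + L D) v = f x v) by (intros; apply Hf).
  assert (Hint : ex_RInt (fun x => f x v) 0 (L D)).
  { eexists. apply (gauss_is_RInt (Gx_gauss D)), (in_Dk_le (k D)); [lia|easy]. }
  rewrite <- (gauss_RInt (Gx_gauss D) (fun x => f' x v)),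
          <- (gauss_RInt (Gx_gauss D) (fun x => f x v))
    by (apply (in_Dk_le (k D)); [lia|easy]).
  set (s := v * dt D / 2).
  rewrite <- (periodic_RInt_shift (fun x => f x v) (L D) (L_pos D) Hper Hint (- s)).
  rewrite <- (gauss_RInt_shifted_cells (Gx_gauss D))
    by (apply (periodic_ex_RInt _ _ (L_pos D) Hper Hint)).
  rewrite <- (in_Dk_RInt_cells (Gx_gauss D) _ _ Dkf').
  apply sum_eq. intros i Hi.
  pose proof (gauss_ncells (Gx_gauss D)).
  assert (H1 := Hstep j q Hj Hq i ltac:(lia) (fun _ => 1)
                  (in_Dk_poly _ _ _ (is_poly_const _ 1))).
  cbv zeta in H1. fold v s in H1. unfold Rminus in H1.
  rewrite (RInt_ext_all _ (fun x => f' x v * 1)) by (intros; ring).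
  rewrite H1. apply RInt_ext_all. intros; ring.
Qed.

Lemma x_half_step_kinetic_energy D f f' :
  dg_density D f -> x_half_step D f f' ->
  quad (k D) (Gx D) (fun x => quad (k D) (Gv D) (fun v => v ^ 2 * f' x v))
  = quad (k D) (Gx D) (fun x => quad (k D) (Gv D) (fun v => v ^ 2 * f x v)).
Proof.
  intros Hf Hstep.
  rewrite (quad_swap _ _ _ _ (fun x v => v ^ 2 * f' x v)).
  rewrite (quad_swap _ _ _ _ (fun x v => v ^ 2 * f x v)).
  apply quad_ext; [apply (gauss_ncells (Gv_gauss D))|]. intros j q Hj Hq.
  rewrite !quad_scal. f_equal. now apply x_half_step_mass.
Qed.

Lemma J_h_quad D f x : J_h D f x = - quad (k D) (Gv D) (fun v => v * f x v).
Proof.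
  unfold J_h, quad. f_equal. apply sum_eq. intros j _. apply sum_eq. intros; ring.
Qed.

Lemma n_h_quad D f x : n_h D f x = quad (k D) (Gv D) (f x).
Proof. easy. Qed.

(** Testing with v^2 turns the new second moment into the integral of
    f (v - s)^2 over the translated velocity domain; as no mass leaves the
    cutoff, that domain may be replaced by the original one. *)
Lemma v_step_second_moment D Eh f f' i p :
  (2 <= k D)%nat -> dg_density D f -> v_step D Eh f f' ->
  (i < ncells (Gx D))%nat -> (p <= k D)%nat ->
  let x := node (Gx D) i p in
  let s := Eh x * dt D in
  (forall j v, (j < ncells (Gv D))%nat ->
     edge (Gv D) j < v < edge (Gv D) (S j) ->
     f x v <> 0 -> - vm D <= v - s <= vm D) ->
  quad (k D) (Gv D) (fun v => v ^ 2 * f' x v)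
  = quad (k D) (Gv D) (fun v => v ^ 2 * f x v) + 2 * s * J_h D f x + s ^ 2 * n_h D f x.
Proof.
  intros Hk Hf [Hf' Hstep] Hi Hp x s Hcut.
  assert (Hx : 0 <= x <= L D) by now apply (gauss_node_range (Gx_gauss D)).
  assert (Hsq : forall r g, in_Dk (k D) (Gv D) g ->
            in_Dk (2 * k D + 1) (Gv D) (fun v => (v - r) ^ 2 * g v)).
  { intros r g Hg. apply (in_Dk_le (2 + k D)); [lia|].
    apply in_Dk_mult; [apply in_Dk_poly, is_poly_shift_sqr|easy]. }
  pose proof (dg_density_slice_v D f x Hf Hx) as Dkf.
  pose proof (dg_density_slice_v D f' x Hf' Hx) as Dkf'.
  set (F := fun v => (v - s) ^ 2 * f x v).
  assert (F_int : ex_RInt F (- vm D) (vm D)).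
  { eexists. now apply (gauss_is_RInt (Gv_gauss D)), Hsq. }
  assert (F_out : forall v, v < - vm D \/ vm D < v -> F v = 0).
  { intros v Hv. unfold F. destruct Hf as (_ & _ & Hzero).
    rewrite Hzero by easy. ring. }
  assert (F_all := compact_support_ex_RInt F _ _ (gauss_le (Gv_gauss D)) F_out F_int).
  assert (Hmoment : quad (k D) (Gv D) (fun v => v ^ 2 * f' x v) = quad (k D) (Gv D) F).
  { transitivity (RInt F (- vm D + s) (vm D + s)).
    - rewrite <- (gauss_RInt_shifted_cells (Gv_gauss D)) by easy.
      assert (Hsq0 : in_Dk (2 * k D + 1) (Gv D) (fun v => v ^ 2 * f' x v)).
      { apply (in_Dk_ext _ _ (fun v => (v - 0) ^ 2 * f' x v)); [intros; ring|].
        now apply Hsq. }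
      rewrite <- (gauss_RInt (Gv_gauss D)) by exact Hsq0.
      rewrite <- (in_Dk_RInt_cells (Gv_gauss D) _ _ Hsq0).
      apply sum_eq. intros j Hj. pose proof (gauss_ncells (Gv_gauss D)).
      assert (H2 := Hstep i p Hi Hp j ltac:(lia) (fun v => (v - 0) ^ 2)
                      (in_Dk_poly _ _ _ (is_poly_le _ _ _ Hk (is_poly_shift_sqr 0)))).
      cbv zeta in H2. fold x s in H2.
      rewrite (RInt_ext_all _ (fun v => f' x v * (v - 0) ^ 2)) by (intros; ring).
      rewrite H2. apply RInt_ext_all. intros; unfold F; ring.
    - rewrite <- (gauss_RInt (Gv_gauss D)) by now apply Hsq.
      apply (gauss_RInt_truncate _ _ _ _ _ _ _ (Gv_gauss D)); try easy.
      + pose proof (vm_pos D). lra.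
      + intros j v Hj Hv HF. assert (f x v <> 0).
        { intros H0. apply HF. unfold F. rewrite H0. ring. }
        specialize (Hcut j v Hj Hv H). lra. }
  rewrite Hmoment, J_h_quad, n_h_quad.
  transitivity (quad (k D) (Gv D) (fun v =>
    v ^ 2 * f x v + (- (2 * s) * (v * f x v) + s ^ 2 * f x v))).
  { apply quad_ext; [apply (gauss_ncells (Gv_gauss D))|]. intros; unfold F; ring. }
  rewrite quad_plus, quad_plus, !quad_scal. ring.
Qed.

(** Cleared of its denominator, the update is an implicit midpoint rule for
    lambda^2 dE/dt = - J, where theta (E + E') accounts for the current gained
    during the step.  Multiplying it by E + E' gives the energy balance. *)
Lemma field_update_energy D fs E E' i p :
  field_update D fs E E' -> (i < ncells (Gx D))%nat -> (p <= k D)%nat ->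
  let x := node (Gx D) i p in
  let s := E_half E E' x * dt D in
  lambda D ^ 2 * E' x ^ 2
  = lambda D ^ 2 * E x ^ 2 - (2 * s * J_h D fs x + s ^ 2 * n_h D fs x).
Proof.
  intros [_ H] Hi Hp x s. destruct (H i p Hi Hp) as [Hne HE']. fold x in Hne, HE'.
  assert (Hmid : lambda D ^ 2 * (E' x - E x)
                 = - dt D * J_h D fs x - theta D fs x * (E' x + E x)).
  { assert (Heq : (lambda D ^ 2 + theta D fs x) * E' x
            = (lambda D ^ 2 - theta D fs x) * E x - dt D * J_h D fs x).
    { rewrite HE'. now field. }
    lra. }
  apply (Rplus_eq_reg_r (- (lambda D ^ 2 * E x ^ 2))).
  transitivity (lambda D ^ 2 * (E' x - E x) * (E' x + E x)); [ring|].
  rewrite Hmid. unfold s, E_half, theta. field.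
Qed.

Theorem proposition3p3 (D : setup) (f fs fss : nat -> R -> R -> R)
    (E : nat -> R -> R)
    (k_ge2 : (2 <= k D)%nat)
    (scheme : ecsldg D f fs fss E)
    (cutoff : cutoff_large_enough D fs E) :
  forall m : nat, (m < M D)%nat ->
    TE D (f (S m)) (E (S m)) = TE D (f m) (E m).
Proof.
  intros m Hm. destruct scheme as (Hf0 & _ & HE0 & Hstep).
  destruct (Hstep m Hm) as (Hx1 & HE & Hv & Hx2).
  assert (Hfm : dg_density D (f m) /\ dg_field D (E m)).
  { destruct m as [|m]; [easy|].
    destruct (Hstep m) as (_ & [HEm _] & _ & [Hfm _]); [lia|easy]. }
  destruct Hfm as [Hfm HEm].
  rewrite !TE_quadrature; try easy; try lia; try apply HE; try apply Hx2.
  f_equal. rewrite !quad_plus.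
  rewrite (x_half_step_kinetic_energy _ _ _ (proj1 Hv) Hx2).
  rewrite <- (x_half_step_kinetic_energy _ _ _ Hfm Hx1).
  rewrite <- !quad_plus.
  apply quad_ext; [apply (gauss_ncells (Gx_gauss D))|]. intros i p Hi Hp.
  rewrite (v_step_second_moment D _ _ _ i p k_ge2 (proj1 Hx1) Hv Hi Hp)
    by (intros j v Hj Hjv; now apply (cutoff m Hm i p Hi Hp j)).
  rewrite (field_update_energy _ _ _ _ i p HE Hi Hp). ring.
Qed.
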